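(* Let $H, J$ be complex Hilbert spaces and let $T \in \mathcal{L}(H,J)$ be a compact operator. Then $T$ is an $\mathcal{AN}$ operator.
   Context: $\mathcal{L}(H,J)$ denotes the space of bounded linear operators from $H$ to $J$ with the operator norm $\|T\|=\sup_{\|x\|_H\le 1}\|Tx\|_J$. ''Subspace'' always means closed subspace. An operator $T\in\mathcal{L}(H,J)$ satisfies property $\mathcal{N}$ if there is $x\in H$ with $\|x\|=1$ and $\|Tx\|=\|T\|$. $T$ is an $\mathcal{AN}$ operator if for every closed subspace $M\subset H$, $M\ne\{0\}$, the restriction $T|_M\in\mathcal{L}(M,J)$ satisfies property $\mathcal{N}$, i.e. there is $x\in M$ with $\|x\|=1$ and $\|Tx\|=\|T|_M\|$. *)

(* Defs.v *)
From HB Require Import structures.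
From mathcomp Require Import all_boot all_order all_algebra.
From mathcomp Require Import sesquilinear complex.
From mathcomp Require Import boolp classical_sets functions reals.
From mathcomp Require Import topology normedtype.

Set Implicit Arguments.
Unset Strict Implicit.
Unset Printing Implicit Defensive.
Import Order.TTheory GRing.Theory Num.Theory.

Local Open Scope classical_set_scope.
Local Open Scope complex_scope.
Local Open Scope ring_scope.

(* The inner product is linear in its first argument and conjugate-linear in
   the second. *)
HB.mixin Record CompleteNormedModule_isHilbert (R : realType) H
    & CompleteNormedModule R[i] H := {
  inner : {dot H for @Num.conj R[i]} ;
  norm_innerE : forall x : H, `|x| = sqrtC (inner x x)
}.

#[short(type="hilbertType")]
HB.structure Definition Hilbert (R : realType) :=
  { H of CompleteNormedModule_isHilbert R H & CompleteNormedModule R[i] H }.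

Section operators.
Context {R : realType}.

(* In a normed module over R[i] the norm `|x| is an element of R[i] (with zero
   imaginary part); suprema are taken in R. *)
Definition normR {V : normedModType R[i]} (x : V) : R := complex.Re `|x|.

Definition bounded_operator {H J : normedModType R[i]} (T : H -> J) : Prop :=
  exists M : R, forall x : H, normR (T x) <= M * normR x.

(* precompact A means that the closure of A is compact *)
Definition compact_operator {H J : normedModType R[i]} (T : H -> J) : Prop :=
  precompact (T @` [set x : H | normR x <= 1]).

Definition closed_subspace {H : normedModType R[i]} (M : set H) : Prop :=
  closed M /\ GRing.submod_closed [in M].

(* The operator norm of the restriction of T to M. As sup is a total function
   on sets of reals, this is meaningful only when T is bounded on M. *)
Definition opnorm {H J : normedModType R[i]} (M : set H) (T : H -> J) : R :=
  sup [set normR (T x) | x in [set x : H | M x /\ normR x <= 1]].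

(* Property N for the restriction of T to M. *)
Definition property_N {H J : normedModType R[i]} (M : set H) (T : H -> J) :
    Prop :=
  exists x : H, [/\ M x, normR x = 1 & normR (T x) = opnorm M T].

Definition AN_operator {H J : normedModType R[i]} (T : H -> J) : Prop :=
  bounded_operator T /\
  forall M : set H, closed_subspace M -> M <> [set 0] -> property_N M T.

End operators.

(* Main.v *)
(* No weak compactness is needed. Let s be the norm of T restricted to M and
   choose x_n in the unit ball of M with |T x_n| -> s; by compactness, along a
   suitable filter the T x_n converge. Then |T (x_m + x_n)| -> 2 s, so
   |x_m + x_n| -> 2 (if s > 0), and the parallelogram identity
   |x_m - x_n|^2 <= 4 - |x_m + x_n|^2 shows that the x_n themselves form a
   Cauchy family. Its limit is in M and attains the norm. *)
Require Import Defs.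
From HB Require Import structures.
From mathcomp Require Import all_boot all_order all_algebra.
From mathcomp Require Import sesquilinear complex.
From mathcomp Require Import boolp classical_sets functions reals.
From mathcomp Require Import topology normedtype.
From mathcomp Require Import ring lra.

Set Implicit Arguments.
Unset Strict Implicit.
Unset Printing Implicit Defensive.
Import Order.TTheory GRing.Theory Num.Theory.
Local Open Scope classical_set_scope.
Local Open Scope complex_scope.
Local Open Scope ring_scope.

Section NormR.
Context {R : realType} {V : normedModType R[i]}.
Implicit Types x y : V.

Lemma normRE x : `|x| = (normR x)%:C.
Proof. by rewrite /normR RRe_real // normr_real. Qed.

Lemma normR_ge0 x : 0 <= normR x.
Proof. by rewrite -ler0c -normRE. Qed.

Lemma normR0 : normR (0 : V) = 0.
Proof. by rewrite /normR normr0. Qed.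

Lemma normR_eq0 x : normR x = 0 -> x = 0.
Proof. by move=> x0; apply/eqP; rewrite -normr_eq0 normRE x0. Qed.

Lemma normRD x y : normR (x + y) <= normR x + normR y.
Proof. by rewrite -lecR rmorphD /= -!normRE ler_normD. Qed.

Lemma normRN x : normR (- x) = normR x.
Proof. by rewrite /normR normrN. Qed.

Lemma normRBC x y : normR (x - y) = normR (y - x).
Proof. by rewrite -normRN opprB. Qed.

Lemma normR_distD x y z : normR (x - z) <= normR (x - y) + normR (y - z).
Proof. by rewrite -[x - z](subrKA y) normRD. Qed.

Lemma ler_subnormR x y : normR x - normR y <= normR (x - y).
Proof. by rewrite lerBlDr -{1}[x](subrK y) normRD. Qed.

Lemma normRZ (a : R) x : normR (a%:C *: x) = `|a| * normR x.
Proof.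
apply: complexI; rewrite -normRE normrZ normRE rmorphM /=; congr (_ * _).
by rewrite normc_def /= expr0n addr0 sqrtr_sqr.
Qed.

Lemma nbhs_normR x (e : R) : 0 < e -> nbhs x [set y | normR (x - y) < e].
Proof.
move=> e0; apply/nbhs_ballP; exists e%:C; first by rewrite /= ltcR.
by move=> y; rewrite -ball_normE /= normRE ltcR.
Qed.

Lemma nbhs_normRP x (B : set V) : nbhs x B ->
  exists2 e : R, 0 < e & [set y | normR (x - y) < e] `<=` B.
Proof.
(* In [R[i]], [0 < e] forces the imaginary part of [e] to vanish, so the real part is the same
   radius read in [R]. *)
case/nbhs_ballP => e /= e0 xB; exists (complex.Re e).
  by move: e0; rewrite ltcE => /andP[].
move=> y /= xy; apply: xB; rewrite -ball_normE /= normRE ltcE /=.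
by rewrite xy andbT; move: e0; rewrite ltcE => /andP[].
Qed.

End NormR.

Section Filters.
Context {R : realType} {V : completeNormedModType R[i]}.

Lemma cauchy_normR_cvg (F : set_system V) : ProperFilter F ->
  (forall e : R, 0 < e ->
    exists2 A : set V, F A & forall x y, A x -> A y -> normR (x - y) < e) ->
  exists x : V, F --> x.
Proof.
move=> FF Fc; apply/cvg_ex; apply: cauchy_cvg.
apply/cauchy_ballP => e e0.
have e0' : 0 < complex.Re e by move: e0; rewrite ltcE => /andP[].
have [A FA Ad] := Fc _ e0'.
exists (A, A) => // -[x y] /= [Ax Ay].
rewrite -ball_normE /= normRE ltcE /= Ad // andbT.
by move: e0; rewrite ltcE => /andP[].
Qed.

End Filters.

Lemma parallelogram {R : realType} {H : hilbertType R} (x y : H) :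
  normR (x + y) ^+ 2 + normR (x - y) ^+ 2 =
  2 * (normR x ^+ 2 + normR y ^+ 2).
Proof.
have sq (z : H) : (normR z ^+ 2)%:C = inner z z.
  by rewrite rmorphXn /= -normRE norm_innerE sqrtCK.
(* Once embedded in [R[i]], the squares expand by sesquilinearity, and the cross terms [c] and [d]
   have opposite signs in the two squares. *)
apply: complexI; rewrite rmorphM !rmorphD /= !sq.
rewrite linearDl linearBl /= !linearDr !linearNr /=.
rewrite rmorph1; set a := inner x x; set b := inner y y.
set c := inner x y; set d := inner y x.
by ring.
Qed.

Section RestrictedOperator.
Context {R : realType} {H J : normedModType R[i]}.
Variables (T : {linear H -> J}) (M : set H).
Hypotheses (T_bounded : bounded_operator T) (M_closed : closed_subspace M).

Lemma closed_subspace0 : M 0.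
Proof. by have [_ [/set_mem]] := M_closed. Qed.

Lemma closed_subspaceZ a x : M x -> M (a *: x).
Proof.
have [_ [M0 ML]] := M_closed; move=> Mx.
by have /set_mem := ML a x 0 (mem_set Mx) M0; rewrite addr0.
Qed.

Lemma closed_subspaceD x y : M x -> M y -> M (x + y).
Proof.
have [_ [_ ML]] := M_closed; move=> Mx My.
by have /set_mem := ML 1 x y (mem_set Mx) (mem_set My); rewrite scale1r.
Qed.

Lemma opnorm_has_sup :
  has_sup [set normR (T x) | x in [set x : H | M x /\ normR x <= 1]].
Proof.
have [C TC] := T_bounded; split.
  exists (normR (T 0)); exists 0 => //=.
  by rewrite normR0 ler01; split=> //; exact: closed_subspace0.
(* The constant [C] carries no sign; with [C < 0] the step from [C * normR x] to [C] would fail. *)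
exists `|C| => _ [x [_ x1] <-]; apply: (le_trans (TC x)).
apply: (le_trans (ler_wpM2r (normR_ge0 x) (ler_norm C))).
by rewrite ler_piMr.
Qed.

Lemma normR_opnorm_unit x : M x -> normR x <= 1 -> normR (T x) <= opnorm M T.
Proof. by move=> Mx x1; apply: sup_upper_bound opnorm_has_sup _ _; exists x. Qed.

Lemma opnorm_ge0 : 0 <= opnorm M T.
Proof.
apply: (le_trans (normR_ge0 (T 0))); apply: normR_opnorm_unit.
  exact: closed_subspace0.
by rewrite normR0.
Qed.

Lemma normalize_subspace x : M x -> x != 0 ->
  exists2 u, M u /\ normR u = 1 & x = (normR x)%:C *: u.
Proof.
move=> Mx x0; have nx : normR x != 0 by apply: contra_neq x0; exact: normR_eq0.
exists ((normR x)^-1%:C *: x).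
  split; first exact: closed_subspaceZ.
  by rewrite normRZ ger0_norm ?invr_ge0 ?normR_ge0 // mulVf.
by rewrite scalerA -rmorphM /= mulfV // scale1r.
Qed.

Lemma normR_opnorm x : M x -> normR (T x) <= opnorm M T * normR x.
Proof.
move=> Mx; have [->|x0] := eqVneq x 0.
  by rewrite linear0 !normR0 mulr0.
have [u [Mu u1] ->] := normalize_subspace Mx x0.
rewrite linearZ /= !normRZ mulrCA ler_wpM2l // u1 mulr1.
by apply: normR_opnorm_unit => //; rewrite u1.
Qed.

Lemma subspace_unit : M <> [set 0] -> exists2 u, M u & normR u = 1.
Proof.
move=> M0; suff [x Mx x0] : exists2 x, M x & x != 0.
  by have [u [Mu u1] _] := normalize_subspace Mx x0; exists u.
apply: contrapT => nM; apply: M0; apply/seteqP; split=> x /=.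
  by move=> Mx; apply/eqP/negP => /negP x0; apply: nM; exists x.
by move=> ->; exact: closed_subspace0.
Qed.

(** For [e > 0] these nested sets form a filter base, which stands in for a maximizing sequence. *)
Definition near_maximizers (e : R) : set H :=
  [set x | [/\ M x, normR x <= 1 & opnorm M T - e < normR (T x)]].

Lemma near_maximizers_neq0 e : 0 < e -> near_maximizers e !=set0.
Proof.
move=> e0; have [_ [x [Mx x1] <-] xe] := sup_adherent e0 opnorm_has_sup.
by exists x.
Qed.

Lemma near_maximizers_le d e :
  d <= e -> near_maximizers d `<=` near_maximizers e.
Proof. by move=> de x [Mx x1 xd]; split=> //; lra. Qed.

(** The image under [T] of the filter generated by the near-maximizers contains the compact set [K],
    hence clusters at some [y]. One [e] controls both the defect in norm and the distance to [y], so
    a single parameter will index the refined filter. *)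
Lemma near_maximizers_cluster : compact_operator T ->
  exists y : J, forall e : R, 0 < e ->
    exists2 x, near_maximizers e x & normR (y - T x) < e.
Proof.
case=> K TK [K_compact _].
pose F := filter_from [set e : R | 0 < e] near_maximizers.
have FF : ProperFilter F.
  apply: filter_from_proper => [|e]; last exact: near_maximizers_neq0.
  apply: filter_from_filter; first by exists 1 => /=.
  move=> d e /= d0 e0; exists (Num.min d e); first by rewrite /= lt_min d0.
  by move=> x xde; split; apply: near_maximizers_le xde; rewrite ge_min lexx ?orbT.
have [|y [_ yF]] := K_compact (T @ F).
  by exists 1 => //= x [_ x1 _]; apply: TK; exists x.
exists y => e e0.
have [|_ [[x xe <-] yx]] :=
  yF (T @` near_maximizers e) [set z | normR (y - z) < e] _ (nbhs_normR y e0).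
  by exists e => // x xe; exists x.
by exists x.
Qed.

End RestrictedOperator.

(** Write s for the norm on [M] and u for [normR (x + y)]. From 2 Tx = T(x + y) + (Tx - Ty) follows
    2(s - e) < s u + 2e, that is s(2 - u) < 4e; the parallelogram identity contributes another
    factor 4. *)
Lemma near_maximizers_dist {R : realType} {H J : hilbertType R}
    (T : {linear H -> J}) (M : set H) (e : R) (x y : H) (z : J) :
  bounded_operator T -> closed_subspace M ->
  near_maximizers T M e x -> near_maximizers T M e y ->
  normR (z - T x) < e -> normR (z - T y) < e ->
  opnorm M T * normR (x - y) ^+ 2 <= 16 * e.
Proof.
move=> Tb Mc [Mx x1 xe] [My y1 ye] zx zy.
have s0 := opnorm_ge0 Tb Mc.
have sxy := normR_opnorm Tb Mc (closed_subspaceD Mc Mx My).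
have Txy : 2 * normR (T x) <= normR (T (x + y)) + normR (T x - T y).
  have -> : 2 * normR (T x) = normR (T (x + y) + (T x - T y)).
    rewrite linearD /= addrACA subrr addr0 -mulr2n -scaler_nat.
    have -> : 2%:R = 2%:C :> R[i] by rewrite rmorph_nat.
    by rewrite normRZ normr_nat.
  exact: normRD.
have zxy := normR_distD (T x) z (T y); rewrite (normRBC (T x) z) in zxy.
have P := parallelogram x y.
have := normR_ge0 x; have := normR_ge0 y; have := normR_ge0 (x + y).
have xy2 : normR (x + y) <= 2 by have := normRD x y; lra.
move: (opnorm M T) (normR (x + y)) (normR x) (normR y) (normR (x - y)) xe ye s0
  sxy Txy xy2 P x1 y1 => s u a b d xe ye s0 su Txy u2 P a1 b1 u0 b0 a0.
(* Since [a] and [b] are at most 1, d^2 <= 4 - u^2 = (2 - u)(2 + u), and u <= 2. *)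
have d2 : d ^+ 2 <= 4 * (2 - u) by nra.
have := ler_wpM2l s0 d2; nra.
Qed.

Theorem mainTheorem1 (R : realType) (H J : hilbertType R) (T : {linear H -> J})
    (T_bounded : bounded_operator T) (T_compact : compact_operator T) :
  AN_operator T.
Proof.
split=> // M M_closed M_neq0.
have [u Mu u1] := subspace_unit M_closed M_neq0.
(* If the norm is 0, every unit vector of [M] attains it; otherwise it can be cancelled from the
   distance estimate. *)
have [s0|s_neq0] := eqVneq (opnorm M T) 0.
  exists u; split=> //; apply/eqP; rewrite eq_le normR_opnorm_unit ?u1 //=.
  by rewrite s0 normR_ge0.
have s_gt0 : 0 < opnorm M T by rewrite lt_neqAle eq_sym s_neq0 opnorm_ge0.
have [y yP] := near_maximizers_cluster T_bounded M_closed T_compact.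
(* Keeping only near-maximizers with image close to [y] turns the cluster point into a limit of the
   images. *)
pose B e := [set x | near_maximizers T M e x /\ normR (y - T x) < e].
pose F := filter_from [set e : R | 0 < e] B.
have FF : ProperFilter F.
  apply: filter_from_proper => [|e /yP[x xe yx]]; last by exists x.
  apply: filter_from_filter; first by exists 1 => /=.
  move=> d e /= d0 e0; exists (Num.min d e); first by rewrite /= lt_min d0.
  move=> x [xde]; rewrite lt_min => /andP[yd ye].
  by split; split=> //; apply: near_maximizers_le xde; rewrite ge_min lexx ?orbT.
have [x Fx] : exists x : H, F --> x.
  apply: cauchy_normR_cvg => e e0.
  (* With this [d], the bound [16 * d] leaves [e ^+ 2 / 2] after cancelling the norm, strictly below
     [e ^+ 2]. *)
  pose d := opnorm M T * e ^+ 2 / 32.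
  have d0 : 0 < d by rewrite divr_gt0 // mulr_gt0 // exprn_gt0.
  exists (B d); first by exists d.
  move=> p q [pd yp] [qd yq].
  have := near_maximizers_dist T_bounded M_closed pd qd yp yq.
  have -> : 16 * d = opnorm M T * (e ^+ 2 / 2) by rewrite /d; field.
  rewrite ler_pM2l // => pq.
  rewrite -(@ltr_pXn2r _ 2) ?nnegrE ?normR_ge0 ?ltW //.
  by have := exprn_gt0 2 e0; lra.
have [C TC] := T_bounded.
have approx e : 0 < e -> exists2 p, near_maximizers T M e p & normR (x - p) < e.
  move=> e0; have FB : F (B e) by exists e.
  have [p [[pe _] xp]] := filter_ex (filterI FB (Fx _ (nbhs_normR x e0))).
  by exists p.
have Mx : M x.
  have [M_cl _] := M_closed; apply: M_cl => A /nbhs_normRP[e e0 eA].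
  by have [p [Mp _ _] xp] := approx _ e0; exists p; split=> //; exact: eA.
have x1 : normR x <= 1.
  apply/ler_addgt0Pr => e e0; have [p [_ p1 _] xp] := approx _ e0.
  by have := ler_subnormR x p; lra.
have Tx : opnorm M T <= normR (T x).
  apply/ler_addgt0Pr => e e0.
  (* The loss is at most [d] from near-maximality plus [|C| * d] from moving [p] to [x]; the extra 1
     also keeps the divisor positive. *)
  have c0 : 0 < `|C| + 1 + 1 by have := normr_ge0 C; lra.
  have [d d0 eE] : exists2 d : R, 0 < d & d * (`|C| + 1 + 1) = e.
    by exists (e / (`|C| + 1 + 1)); rewrite ?divr_gt0 // divfK // gt_eqF.
  have [p [_ _ Tp] xp] := approx _ d0.
  have Tpx : normR (T p) - normR (T x) <= C * normR (x - p).
    by rewrite normRBC (le_trans _ (TC _)) // linearB ler_subnormR.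
  have := ler_wpM2r (normR_ge0 (x - p)) (ler_norm C).
  have := ler_wpM2l (normr_ge0 C) (ltW xp).
  by lra.
(* The limit is so far only in the unit ball; s <= |Tx| <= s |x| with s > 0 puts it on the
   sphere. *)
have xE : normR x = 1.
  apply/eqP; rewrite eq_le x1 /=.
  by rewrite -(ler_pM2l s_gt0) mulr1 (le_trans Tx) // normR_opnorm.
exists x; split=> //; apply/eqP.
by rewrite eq_le Tx andbT normR_opnorm_unit.
Qed.
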